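(* Let $\mathcal{X}$ be a set containing at least two distinct elements, and consider the competitive scepticism game with parameter $\mathcal{X}$, together with the notions of capital calibrator, domination, strict domination and admissibility, as defined in the context. Then: 1. An increasing function $F:[1,\infty)\to[0,\infty)$ is a capital calibrator if and only if $$\int_1^{\infty}\frac{F(y)}{y^2}\,\mathrm{d}y\le 1.$$ 2. Any capital calibrator is dominated by an admissible capital calibrator. 3. A capital calibrator $F$ is admissible if and only if it is right-continuous and $$\int_1^{\infty}\frac{F(y)}{y^2}\,\mathrm{d}y=1.$$
   Context: ''Increasing'' and ''positive'' are understood in the wide (non-strict) sense. $\overline{\mathbb{R}}=[-\infty,\infty]$, with the convention $\infty+(-\infty):=\infty$; $\overline{\mathbb{R}}^{\mathcal{X}}$ is the set of all functions $f:\mathcal{X}\to\overline{\mathbb{R}}$, and $[0,\infty]^{\mathcal{X}}$ the set of all functions $\mathcal{X}\to[0,\infty]$. An outer probability content on $\mathcal{X}$ is a function $\mathcal{E}:\overline{\mathbb{R}}^{\mathcal{X}}\to\overline{\mathbb{R}}$ satisfying: (1) if $f,g\in\overline{\mathbb{R}}^{\mathcal{X}}$ and $f\le g$ pointwise, then $\mathcal{E}(f)\le\mathcal{E}(g)$; (2) if $f\in\overline{\mathbb{R}}^{\mathcal{X}}$ and $c\in(0,\infty)$, then $\mathcal{E}(cf)=c\,\mathcal{E}(f)$; (3) if $f,g\in\overline{\mathbb{R}}^{\mathcal{X}}$, then $\mathcal{E}(f+g)\le\mathcal{E}(f)+\mathcal{E}(g)$; (4) for each $c\in\mathbb{R}$,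 $\mathcal{E}$ of the constant function $c$ equals $c$. Let $\mathbf{E}$ be the set of all outer probability contents on $\mathcal{X}$. The competitive scepticism game (with parameter $\mathcal{X}$) is a perfect-information game between Forecaster, Sceptic, Rival Sceptic and Reality. Initially $\mathcal{K}_0:=1$ and $\mathcal{K}'_0:=1$. At each step $n=1,2,\ldots$ the following moves are made, in this order, each player seeing all previous moves: - Forecaster announces $\mathcal{E}_n\in\mathbf{E}$; - Sceptic announces $f_n\in[0,\infty]^{\mathcal{X}}$ such that $\mathcal{E}_n(f_n)\le\mathcal{K}_{n-1}$; - Rival Sceptic announces $f'_n\in[0,\infty]^{\mathcal{X}}$ such that $\mathcal{E}_n(f'_n)\le\mathcal{K}'_{n-1}$; - Reality announces $x_n\in\mathcal{X}$; - the capitals are updated: $\mathcal{K}_n:=f_n(x_n)$ and $\mathcal{K}'_n:=f'_n(x_n)$. A strategy for Rival Sceptic specifies, at each step $n$, his legal move $f'_n$ as a function of the moves made before it (in particular, of $\mathcal{E}_1,f_1,x_1,\ldots,\mathcal{E}_{n-1},f_{n-1},x_{n-1},\mathcal{E}_n,f_n$). It guarantees a property if the property holds for all legal moves of the other players. Put $\mathcal{K}^*_n:=\max_{0\le i\le n}\mathcal{K}_i\in[1,\infty]$. An increasing function $F:[1,\infty)\to[0,\infty)$ is a capital calibrator if there exists a strategy for Rival Sceptic that guarantees $\mathcal{K}'_n\ge F(\mathcal{K}^*_n)$ for all $n$, where $F(\infty)$ is understood to be $\lim_{y\to\infty}F(y)$. A capital calibrator $F$ dominates a capital calibrator $G$ if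 $F(y)\ge G(y)$ for all $y\in[1,\infty)$; $F$ strictly dominates $G$ if $F$ dominates $G$ and $F(y)>G(y)$ for some $y\in[1,\infty)$. A capital calibrator is admissible if it is not strictly dominated by any other capital calibrator. *)

(* Defs.v *)
From HB Require Import structures.
From mathcomp Require Import all_boot all_order all_algebra.
From mathcomp Require Import all_classical all_reals all_analysis.

Set Implicit Arguments.
Unset Strict Implicit.
Unset Printing Implicit Defensive.

Import Order.TTheory GRing.Theory Num.Theory.
Import numFieldNormedType.Exports.

Local Open Scope classical_set_scope.
Local Open Scope ring_scope.
Local Open Scope ereal_scope.

(* Additions are the dual ones (%dE), for which +oo + -oo = +oo; the ordinary
   addition of \bar R takes the value -oo there. *)
Record outer_content (R : realType) (X : Type) := OuterContent {
  outer_val :> (X -> \bar R) -> \bar R ;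
  outer_le : forall f g : X -> \bar R,
    (forall x, f x <= g x) -> outer_val f <= outer_val g ;
  outer_scale : forall (f : X -> \bar R) (c : R), (0 < c)%R ->
    outer_val (fun x => c%:E * f x) = c%:E * outer_val f ;
  outer_subadd : forall f g : X -> \bar R,
    outer_val (fun x => (f x + g x)%dE) <= (outer_val f + outer_val g)%dE ;
  outer_cst : forall c : R, outer_val (fun=> c%:E) = c%:E
}.

Record round (R : realType) (X : Type) := Round {
  forecaster : outer_content R X ;
  sceptic : X -> \bar R ;
  rival : X -> \bar R ;
  reality : X
}.

(* Rounds are numbered from 0: [p n] is the round leading to the capital at
   time n.+1. The argument [player] is [@sceptic R X] or [@rival R X]. *)
Definition play (R : realType) (X : Type) := nat -> round R X.

Definition capital (R : realType) (X : Type)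
    (player : round R X -> X -> \bar R) (p : play R X) (n : nat) : \bar R :=
  if n is m.+1 then player (p m) (reality (p m)) else 1.

Definition legal_move (R : realType) (X : Type)
    (E : outer_content R X) (K : \bar R) (f : X -> \bar R) : Prop :=
  (forall x, 0 <= f x) /\ E f <= K.

Definition plays_legally (R : realType) (X : Type)
    (player : round R X -> X -> \bar R) (p : play R X) : Prop :=
  forall n, legal_move (forecaster (p n)) (capital player p n) (player (p n)).

(* A strategy for Rival Sceptic: the completed rounds in chronological order,
   then the moves of Forecaster and Sceptic in the current round. *)
Definition strategy (R : realType) (X : Type) :=
  seq (round R X) -> outer_content R X -> (X -> \bar R) -> (X -> \bar R).

Definition follows (R : realType) (X : Type)
    (S : strategy R X) (p : play R X) : Prop :=
  forall n, rival (p n) = S (mkseq p n) (forecaster (p n)) (sceptic (p n)).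

(* The moves of Forecaster and Reality are unrestricted, so a play is legal for
   the opponents of Rival Sceptic as soon as Sceptic plays legally. *)
Definition legal_strategy (R : realType) (X : Type) (S : strategy R X) : Prop :=
  forall p : play R X, plays_legally (@sceptic R X) p -> follows S p ->
    plays_legally (@rival R X) p.

Definition guarantees (R : realType) (X : Type)
    (S : strategy R X) (P : play R X -> Prop) : Prop :=
  forall p : play R X, plays_legally (@sceptic R X) p -> follows S p -> P p.

Definition max_capital (R : realType) (X : Type) (p : play R X) (n : nat)
    : \bar R :=
  \big[maxe/-oo]_(i < n.+1) capital (@sceptic R X) p i.

(* A function [1, +oo) -> [0, +oo) is represented by any extension of it to R;
   the definitions below only depend on its values on [1, +oo). *)
Definition increasing_from1 (R : realType) (F : R -> R) : Prop :=
  (forall y, 1 <= y -> 0 <= F y)%R /\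
  (forall y z, 1 <= y -> y <= z -> F y <= F z)%R.

(* The value at -oo is never used, since 1 <= max_capital p n. *)
Definition extend_oo (R : realType) (F : R -> R) (y : \bar R) : \bar R :=
  match y with
  | r%:E => (F r)%:E
  | +oo => lim ((F z)%:E @[z --> +oo%R])
  | -oo => 0
  end.

Definition capital_calibrator (R : realType) (X : Type) (F : R -> R) : Prop :=
  increasing_from1 F /\
  exists S : strategy R X, legal_strategy S /\
    guarantees S (fun p => forall n,
      extend_oo F (max_capital p n) <= capital (@rival R X) p n).

Definition dominates (R : realType) (F G : R -> R) : Prop :=
  (forall y, 1 <= y -> G y <= F y)%R.

Definition strictly_dominates (R : realType) (F G : R -> R) : Prop :=
  dominates F G /\ (exists y, 1 <= y /\ G y < F y)%R.

Definition admissible (R : realType) (X : Type) (F : R -> R) : Prop :=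
  capital_calibrator X F /\
  ~ exists G, capital_calibrator X G /\ strictly_dominates G F.

Definition right_continuous_from1 (R : realType) (F : R -> R) : Prop :=
  forall y : R, (1 <= y)%R -> F z @[z --> y^'+] --> F y.

Definition calibration_integral (R : realType) (F : R -> R) : \bar R :=
  \int[lebesgue_measure]_(y in `[1%R, +oo[) (F y / y ^+ 2)%:E.

(* Main.v *)
Require Import Defs.
From HB Require Import structures.
From mathcomp Require Import all_boot all_order all_algebra.
From mathcomp Require Import all_classical all_reals all_analysis.
From mathcomp Require Import measurable_realfun ring lra.
Import Order.TTheory GRing.Theory Num.Theory.
Import numFieldNormedType.Exports DualAddTheory.
Local Open Scope classical_set_scope.
Local Open Scope ring_scope.
Local Open Scope ereal_scope.

(* Sufficiency: splitting the initial capital over the strategies "follow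
   Sceptic until his capital reaches u, then stop", with weights
   P(du) = dF(u) / u, yields at running maximum M and current capital K the
   capital F(M) + H(M) K with H(M) = P((M, oo)).  Written with
   H(y) = int_y^oo F(u)/u^2 du - F(y)/y, this involves only the constants F(M)
   and H(M), so that finite subadditivity of the outer contents suffices.

   Necessity: Forecaster announces the expectation on two points a, b with
   probability 1/q for a, Sceptic stakes everything on a.  Rival Sceptic must
   hold F(q^n) whenever Reality answers b after n answers a, which bounds a
   lower Darboux sum of the integral on the grid q^n; on this grid the upper
   sums exceed the lower ones by a factor q at most.

   Admissibility: a calibrator can be improved by passing to its right limits,
   which does not change the bounds on the Darboux sums up to a factor q, and
   then by adding the missing mass of the integral as a constant. *)

(** * Integrals of increasing functions against [dy / y^2] *)

Section inverse_square_integral.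
Context {R : realType}.
Local Notation mu := (@lebesgue_measure R).
Implicit Types (F : R -> R) (a b : R).

Lemma measurable_increasing_from1 F (i : interval R) :
  increasing_from1 F -> [set` i] `<=` `[1%R, +oo[ ->
  measurable_fun [set` i] (EFin \o (fun y => F y / y ^+ 2)%R).
Proof.
move=> [_ Fle] i1; apply/measurable_EFinP.
apply: measurable_funM.
  (* Monotonicity of [F] is known only from 1 on, so [F] is replaced by a function monotone on all
     of [R] that agrees with it on [i]. *)
  apply: (eq_measurable_fun (fun y : R => F (Num.max 1%R y))).
    move=> y /set_mem /i1 /=; rewrite in_itv/= andbT => y1.
    by rewrite max_r.
  apply: nondecreasing_measurable => // y z yz; apply: Fle.
    by rewrite le_max lexx.
  by rewrite ge_max !le_max lexx yz orbT.
apply: (eq_measurable_fun (fun y : R => (y ^-1) ^+ 2)%R).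
  by move=> y _; rewrite exprVn.
apply: measurable_funX.
apply: subspace_continuous_measurable_fun => //.
apply: continuous_in_subspaceT => y /set_mem /i1 /=.
rewrite in_itv/= andbT => y1.
by apply: inv_continuous; rewrite gt_eqF// (lt_le_trans _ y1).
Qed.

Lemma integral_inverse_square_ray a : (1 <= a)%R ->
  \int[mu]_(y in `[a, +oo[) ((y ^+ 2)^-1)%:E = (a^-1)%:E.
Proof.
move=> a1; have a0 : (0 < a)%R by rewrite (lt_le_trans _ a1).
rewrite (@ge0_continuous_FTC2y _ _ (fun y => - y^-1)%R _ 0%R).
- by rewrite EFinN oppeK add0e.
- by move=> y _; rewrite invr_ge0 sqr_ge0.
- apply: continuous_in_subspaceT => y /set_mem /=; rewrite in_itv/= andbT => ya.
  apply: (@continuous_comp _ _ _ (fun x : R => x ^+ 2)%R GRing.inv).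
    exact: exprn_continuous.
  by apply: inv_continuous; rewrite expf_neq0// gt_eqF// (lt_le_trans _ ya).
- rewrite -oppr0; apply: cvgN; apply/gtr0_cvgV0.
    by near=> y; near: y; exact: nbhs_pinfty_gt.
  exact: cvg_id.
- move=> y ya; have y0 : (y != 0)%R by rewrite gt_eqF// (lt_trans a0).
  apply: derivableN; exact: derivableV.
- apply: cvg_at_right_filter; apply: cvgN; apply: inv_continuous.
  by rewrite gt_eqF.
- move=> y; rewrite in_itv/= andbT => ya.
  have y0 : (y != 0)%R by rewrite gt_eqF// (lt_trans a0).
  rewrite derive1E deriveN ?deriveV//; last exact: derivableV.
  by rewrite derive_id scaleNr opprK /GRing.scale/= mulr1.
Unshelve. all: by end_near. Qed.


Lemma increasing_from1_cst c : (0 <= c)%R -> increasing_from1 (fun=> c : R).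
Proof. by []. Qed.

Lemma increasing_from1_div_ge0 F y : increasing_from1 F -> (1 <= y)%R ->
  0 <= (F y / y ^+ 2)%:E.
Proof. by move=> [F0 _] y1; rewrite lee_fin divr_ge0 ?sqr_ge0// F0. Qed.

Lemma tail_integral_split F a b : increasing_from1 F -> (1 <= a)%R ->
  (a <= b)%R ->
  \int[mu]_(y in `[a, +oo[) (F y / y ^+ 2)%:E =
  \int[mu]_(y in `[a, b[) (F y / y ^+ 2)%:E +
  \int[mu]_(y in `[b, +oo[) (F y / y ^+ 2)%:E.
Proof.
move=> incF a1 ab.
have U : `[a, +oo[%classic = `[a, b[ `|` `[b, +oo[ :> set R.
  by rewrite -itv_bndbnd_setU// bnd_simp.
rewrite U ge0_integral_setU//.
- rewrite -U; apply: measurable_increasing_from1 => // y /=.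
  by rewrite !in_itv/= !andbT; exact: le_trans.
- move=> y; rewrite -U/= in_itv/= andbT => ay.
  by rewrite increasing_from1_div_ge0// (le_trans a1).
- apply/disj_setPS => y [/=]; rewrite !in_itv/= andbT => /andP[_ yb] yb'.
  by move: yb; rewrite ltNge yb'.
Qed.

Lemma tail_integral_cst c a : (0 <= c)%R -> (1 <= a)%R ->
  \int[mu]_(y in `[a, +oo[) (c / y ^+ 2)%:E = (c / a)%:E.
Proof.
move=> c0 a1; under eq_integral do rewrite EFinM.
rewrite ge0_integralZl_EFin//.
- by rewrite integral_inverse_square_ray.
- by move=> y _; rewrite lee_fin invr_ge0 sqr_ge0.
- have := @measurable_increasing_from1 (fun=> 1%R) `[a, +oo[.
  under [X in measurable_fun _ X]eq_fun do rewrite div1r.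
  apply; first exact: increasing_from1_cst.
  by move=> y /=; rewrite !in_itv/= !andbT; exact: le_trans.
Qed.

Lemma integral_cst_inverse_square c a b : (0 <= c)%R -> (1 <= a)%R ->
  (a <= b)%R ->
  \int[mu]_(y in `[a, b[) (c / y ^+ 2)%:E = (c * (a^-1 - b^-1))%:E.
Proof.
move=> c0 a1 ab; have b1 := le_trans a1 ab.
have := tail_integral_split _ a b (increasing_from1_cst c c0) a1 ab.
rewrite !tail_integral_cst// => /esym/eqP.
rewrite eq_sym -sube_eq// => [/eqP <-|].
  by rewrite -EFinB mulrBr.
by rewrite fin_num_adde_defl.
Qed.

Section bounds.
Context (F : R -> R) (a b : R).
Hypotheses (incF : increasing_from1 F) (a1 : (1 <= a)%R) (ab : (a <= b)%R).

Let sub : `[a, b[ `<=` `[1%R, +oo[.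
Proof.
by move=> y /=; rewrite !in_itv/= andbT => /andP[ay _]; exact: le_trans ay.
Qed.

Let ge1 y : `[a, b[%classic y -> (1 <= y)%R.
Proof. by move=> /sub; rewrite /= in_itv/= andbT. Qed.

Lemma integral_increasing_ge :
  (F a * (a^-1 - b^-1))%:E <= \int[mu]_(y in `[a, b[) (F y / y ^+ 2)%:E.
Proof.
have Fa0 : (0 <= F a)%R by exact: incF.1.
rewrite -integral_cst_inverse_square//; apply: ge0_le_integral => //.
- by move=> y _; rewrite lee_fin divr_ge0// sqr_ge0.
- exact: (measurable_increasing_from1 (fun=> F a)).
- exact: measurable_increasing_from1.
- move=> y yab; rewrite lee_fin ler_wpM2r ?invr_ge0 ?sqr_ge0//.
  by apply: incF.2 => //; move: yab; rewrite /= in_itv/= => /andP[].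
Qed.

Lemma integral_increasing_le :
  \int[mu]_(y in `[a, b[) (F y / y ^+ 2)%:E <= (F b * (a^-1 - b^-1))%:E.
Proof.
have Fb0 : (0 <= F b)%R by apply: incF.1; exact: le_trans ab.
rewrite -integral_cst_inverse_square//; apply: ge0_le_integral => //.
- by move=> y /ge1; exact: increasing_from1_div_ge0.
- exact: measurable_increasing_from1.
- exact: (measurable_increasing_from1 (fun=> F b)).
- move=> y yab; rewrite lee_fin ler_wpM2r ?invr_ge0 ?sqr_ge0//.
  apply: incF.2; first exact: ge1.
  by move: yab; rewrite /= in_itv/= => /andP[_ /ltW].
Qed.

End bounds.

(** Bounding [F] below by [F a] on the ray gives the estimate, which amounts to the nonnegativity of
    [stake]. *)
Lemma tail_integral_ge F a : increasing_from1 F -> (1 <= a)%R ->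
  (F a / a)%:E <= \int[mu]_(y in `[a, +oo[) (F y / y ^+ 2)%:E.
Proof.
move=> incF a1; have Fa0 : (0 <= F a)%R by exact: incF.1.
have sub : `[a, +oo[ `<=` `[1%R, +oo[.
  by move=> y /=; rewrite !in_itv/= !andbT; exact: le_trans.
rewrite -tail_integral_cst//; apply: ge0_le_integral => //.
- by move=> y _; rewrite lee_fin divr_ge0// sqr_ge0.
- exact: (measurable_increasing_from1 (fun=> F a)).
- exact: measurable_increasing_from1.
- move=> y; rewrite /= in_itv/= andbT => ya.
  by rewrite lee_fin ler_wpM2r ?invr_ge0 ?sqr_ge0// incF.2.
Qed.

(** * Darboux sums on the grid [q ^+ n] *)

Section geometric_grid.
Context (F : R -> R) (q : R).
Hypotheses (incF : increasing_from1 F) (q1 : (1 < q)%R).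

Let grid1 n : (1 <= q ^+ n)%R. Proof. by rewrite exprn_ege1// ltW. Qed.

Let gridS n : (q ^+ n <= q ^+ n.+1)%R.
Proof. by rewrite ler_eXn2l. Qed.

Let grid_split N :
  \int[mu]_(y in `[1%R, (q ^+ N.+1)%R[) (F y / y ^+ 2)%:E =
  \int[mu]_(y in `[1%R, (q ^+ N)%R[) (F y / y ^+ 2)%:E +
  \int[mu]_(y in `[(q ^+ N)%R, (q ^+ N.+1)%R[) (F y / y ^+ 2)%:E.
Proof.
have U : `[1%R, (q ^+ N.+1)%R[%classic =
         `[1%R, (q ^+ N)%R[ `|` `[(q ^+ N)%R, (q ^+ N.+1)%R[ :> set R.
  by rewrite -itv_bndbnd_setU// bnd_simp.
rewrite U ge0_integral_setU//.
- rewrite -U; apply: measurable_increasing_from1 => // y /=.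
  by rewrite !in_itv/= andbT => /andP[].
- move=> y; rewrite -U/= in_itv/= => /andP[y1 _].
  exact: increasing_from1_div_ge0.
- apply/disj_setPS => y [/=]; rewrite !in_itv/= => /andP[_ yb] /andP[yb' _].
  by move: yb; rewrite ltNge yb'.
Qed.

Let grid0 : \int[mu]_(y in `[1%R, (q ^+ 0)%R[) (F y / y ^+ 2)%:E = 0.
Proof. by rewrite set_itv_ge ?integral_set0// bnd_simp expr0 ltxx. Qed.

Lemma lower_sum_le N :
  (\sum_(i < N) F (q ^+ i) * ((q ^+ i)^-1 - (q ^+ i.+1)^-1))%:E <=
  calibration_integral F.
Proof.
apply: (@le_trans _ _ (\int[mu]_(y in `[1%R, (q ^+ N)%R[) (F y / y ^+ 2)%:E)).
  elim: N => [|N IH]; first by rewrite big_ord0 grid0.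
  rewrite big_ord_recr/= grid_split EFinD leeD//.
  exact: integral_increasing_ge.
rewrite /calibration_integral (tail_integral_split _ _ (q ^+ N))// leeDl//.
apply: integral_ge0 => y /=; rewrite in_itv/= andbT => yq.
by rewrite increasing_from1_div_ge0// (le_trans (grid1 N)).
Qed.

(** The intervals from 1 to [q ^+ N] exhaust the ray, so monotone convergence carries the bound over
    to the whole integral. *)
Lemma upper_sum_ge (c : \bar R) :
  (forall N, (\sum_(i < N) F (q ^+ i.+1) *
     ((q ^+ i)^-1 - (q ^+ i.+1)^-1))%:E <= c) ->
  calibration_integral F <= c.
Proof.
move=> Fc.
have U : `[1%R, +oo[%classic = \bigcup_N `[1%R, (q ^+ N)%R[%classic :> set R.
  apply/seteqP; split=> [y /=|y [N _] /=]; rewrite !in_itv/= ?andbT.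
    move=> y1; have y0 : (0 < y)%R by rewrite (lt_le_trans _ y1).
    have q01 : (`|q^-1| < 1)%R.
      have q0 : (0 < q)%R by rewrite (lt_trans _ q1).
      by rewrite ger0_norm ?invf_lt1// invr_ge0 ltW.
    have /cvgr_lt/(_ y^-1%R) := cvg_expr q01.
    rewrite invr_gt0 => /(_ y0)[N _ /(_ N (leqnn N)) /= qNy].
    exists N => //=; rewrite in_itv/= y1/=.
    by move: qNy; rewrite exprVn ltf_pV2 ?posrE// exprn_gt0// (lt_trans _ q1).
  by move=> /andP[].
have sub N : `[1%R, (q ^+ N)%R[ `<=` `[1%R, +oo[.
  by move=> y /=; rewrite !in_itv/= andbT => /andP[].
rewrite /calibration_integral U.
have mF N : measurable_fun `[1%R, (q ^+ N)%R[
    (EFin \o (fun y => F y / y ^+ 2)%R).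
  exact: measurable_increasing_from1.
have F0 N y : `[1%R, (q ^+ N)%R[%classic y -> 0 <= (F y / y ^+ 2)%:E.
  by move=> /sub; rewrite /= in_itv/= andbT; exact: increasing_from1_div_ge0.
have ndI : nondecreasing_seq (fun N => `[1%R, (q ^+ N)%R[%classic : set R).
  apply/nondecreasing_seqP => N; rewrite subsetEset; apply: subset_itvl.
  by rewrite bnd_simp.
have cvgF := @ge0_nondecreasing_set_cvg_integral _ _ _ _ _ mu ndI
  (fun=> measurable_itv _) mF F0.
rewrite -(cvg_lim _ cvgF)//; apply: lime_le.
  by apply/cvg_ex; eexists; exact: cvgF.
apply: nearW => N; apply: le_trans (Fc N).
elim: N => [|N IH]; first by rewrite big_ord0 grid0.
rewrite big_ord_recr/= grid_split EFinD leeD//.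
exact: integral_increasing_le.
Qed.


End geometric_grid.


(** Cell [i] weighs [q] times as much as cell [i.+1], so each upper term is [q] times the next lower
    term; the first lower term is nonnegative and is dropped. *)
Lemma upper_sum_le F q N : increasing_from1 F -> (1 < q)%R ->
  (\sum_(i < N) F (q ^+ i.+1) * ((q ^+ i)^-1 - (q ^+ i.+1)^-1) <=
   q * \sum_(i < N.+1) F (q ^+ i) * ((q ^+ i)^-1 - (q ^+ i.+1)^-1))%R.
Proof.
move=> incF q1; have q0 : (0 < q)%R by rewrite (lt_trans _ q1).
rewrite big_ord_recl mulrDr mulr_sumr -[leLHS]add0r lerD//=.
  rewrite expr0 expr1 invr1 !mulr_ge0 ?(ltW q0) ?incF.1//.
  by rewrite subr_ge0 invf_le1// ltW.
apply: ler_sum => i _; rewrite [leRHS]mulrCA le_eqVlt; apply/orP; left.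
apply/eqP; congr (_ * _)%R.
by rewrite /bump/= !exprS; field; rewrite expf_neq0 ?gt_eqF.
Qed.

(** The lower sums may reach [q] instead of 1, a slack that right limits will use. The upper sums
    then stay below [q ^+ 2], and [q] tends to 1. *)
Lemma calibration_integral_le1 F : increasing_from1 F ->
  (forall q N, (1 < q)%R ->
    (\sum_(i < N) F (q ^+ i) * ((q ^+ i)^-1 - (q ^+ i.+1)^-1) <= q)%R) ->
  calibration_integral F <= 1.
Proof.
move=> incF Fq.
have upper q : (1 < q)%R -> calibration_integral F <= (q ^+ 2)%:E.
  move=> q1; have q0 : (0 < q)%R by rewrite (lt_trans _ q1).
  apply: (upper_sum_ge _ _ incF q1) => N; rewrite lee_fin.
  apply: le_trans (upper_sum_le _ _ _ incF q1) _.
  by rewrite expr2 ler_pM2l//; exact: Fq.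
(* Since [d <= 1], [(1 + d) ^+ 2 <= 1 + 3 * d], and [3 * d <= e]. *)
apply/lee_addgt0Pr => e e0; pose d := (Num.min e 1 / 3)%R.
have d0 : (0 < d)%R by rewrite divr_gt0// lt_min e0 ltr01.
have d1 : (d <= 1)%R by rewrite ler_pdivrMr// ge_min orbC; lra.
have de : (3 * d <= e)%R by rewrite mulrC divfK// ge_min lexx.
apply: (@le_trans _ _ ((1 + d) ^+ 2)%:E); first by apply: upper; lra.
rewrite -EFinD lee_fin; nra.
Qed.

End inverse_square_integral.

(** * Sufficiency: the mixture of stopped strategies *)

Section strategy.
Context {R : realType} (X : Type) (F : R -> R).
Hypotheses (incF : increasing_from1 F) (intF : calibration_integral F <= 1).
Local Notation mu := (@lebesgue_measure R).
Implicit Types (a b y z : R) (m k : \bar R).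

Let tail a : R := fine (\int[mu]_(y in `[a, +oo[) (F y / y ^+ 2)%:E).

Let tail_fin a : (1 <= a)%R ->
  (tail a)%:E = \int[mu]_(y in `[a, +oo[) (F y / y ^+ 2)%:E.
Proof.
move=> a1; rewrite /tail fineK// ge0_fin_numE.
  apply: (@le_lt_trans _ _ 1); last exact: ltey.
  apply: le_trans intF; rewrite /calibration_integral.
  rewrite (tail_integral_split F 1%R a)// leeDr//.
  by apply: integral_ge0 => y /=; rewrite in_itv/= => /andP[y1 _];
    exact: increasing_from1_div_ge0.
apply: integral_ge0 => y /=; rewrite in_itv/= andbT => ya.
by rewrite increasing_from1_div_ge0// (le_trans a1).
Qed.

(* P((a, oo)) for P(du) = dF(u) / u, integrated by parts. *)
Definition stake a : R := (tail a - F a / a)%R.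

Lemma stake_ge0 a : (1 <= a)%R -> (0 <= stake a)%R.
Proof.
by move=> a1; rewrite subr_ge0 -lee_fin tail_fin// tail_integral_ge.
Qed.

(** In terms of P, the integral of [u] over [(y, z]] is at most [z] times the mass of [(y, z]]. The
    proof bounds [F] below by [F y] between [y] and [z]. *)
Lemma stake_decrease y z : (1 <= y)%R -> (y <= z)%R ->
  (F z - F y <= z * (stake y - stake z))%R.
Proof.
move=> y1 yz; have z1 := le_trans y1 yz.
have z0 : (0 < z)%R by rewrite (lt_le_trans _ z1).
have y0 : (0 < y)%R by rewrite (lt_le_trans _ y1).
have : (F y * (y^-1 - z^-1) + tail z <= tail y)%R.
  rewrite -lee_fin EFinD !tail_fin// (tail_integral_split F y z)// leeD2r//.
  exact: integral_increasing_ge.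
rewrite /stake => tyz; have -> : (z * (tail y - F y / y - (tail z - F z / z)) =
   z * (tail y - tail z) - z * (F y / y) + F z)%R.
  by field; rewrite !gt_eqF.
have : (z * (F y * (y^-1 - z^-1)) <= z * (tail y - tail z))%R.
  by rewrite ler_pM2l//; lra.
have -> : (z * (F y * (y^-1 - z^-1)) = z * (F y / y) - F y)%R.
  by field; rewrite !gt_eqF.
lra.
Qed.

(** The left side equals the whole calibration integral, so the initial capital 1 finances the
    mixture. *)
Lemma stake_init : (F 1 + stake 1 <= 1)%R.
Proof.
by rewrite /stake divr1 addrCA subrr addr0 -lee_fin tail_fin.
Qed.

(** At [m = +oo] every level has been passed and nothing follows Sceptic any more; the maximum with
    0 gives nonnegativity without studying the limit. *)
Definition bank m k : \bar R :=
  if m is r%:E then (F r)%:E + (stake r)%:E * k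
  else maxe 0 (extend_oo F +oo).

Lemma bank_ge0 m k : 1 <= m -> 0 <= k -> 0 <= bank m k.
Proof.
case: m => [r| |]//= r1 k0; last by rewrite le_max lexx.
by rewrite adde_ge0 ?mule_ge0 ?lee_fin ?stake_ge0 ?incF.1.
Qed.

Lemma extend_oo_le_bank m k : 1 <= m -> 0 <= k -> extend_oo F m <= bank m k.
Proof.
case: m => [r| |]//= r1 k0; last by rewrite le_max lexx orbT.
by rewrite leeDl// mule_ge0// lee_fin stake_ge0.
Qed.

(** At a new maximum [k] the stake drops from [stake m] to [stake k]; by [stake_decrease] the money
    released covers the increase of [F]. *)
Lemma bank_max m k : 1 <= m -> 0 <= k -> bank (maxe m k) k <= bank m k.
Proof.
case: m => [r| |]//; last by move=> _ _; rewrite maxye.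
rewrite lee_fin => r1; have [|rk _] := leP k r%:E; first by [].
case: k rk => [s| |]//.
- rewrite lte_fin => rs; rewrite /= -!EFinM -!EFinD lee_fin.
  have := stake_decrease _ _ r1 (ltW rs); rewrite mulrBr; lra.
(* For [k = +oo], a positive stake makes the right side infinite. A zero stake cannot decrease
   further, which freezes [F] beyond [r], so its limit is [F r]. *)
- move=> _ /=; have := stake_ge0 _ r1; rewrite le_eqVlt => /predU1P[r0|r0].
    have Fr z : (r <= z)%R -> F z = F r.
      move=> rz; apply/eqP; rewrite eq_le (incF.2 r z)// andbT.
      have := stake_decrease _ _ r1 rz; rewrite -r0.
      have z0 : (0 <= z)%R by rewrite (le_trans _ rz)// (le_trans _ r1).
      have := mulr_ge0 z0 (stake_ge0 _ (le_trans r1 rz)); lra.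
    have -> : lim ((F z)%:E @[z --> +oo%R]) = (F r)%:E.
      apply/cvg_lim => //; apply: cvg_near_cst.
      by near=> z; rewrite Fr//; near: z; exact: nbhs_pinfty_ge.
    by rewrite -r0 mul0e adde0 max_r// lee_fin incF.1.
  by rewrite gt0_muley ?lte_fin// addey// leey.
Unshelve. all: by end_near. Qed.

Lemma outer_bank (E : outer_content R X) (f : X -> \bar R) m k :
  1 <= m -> (forall x, 0 <= f x) -> E f <= k ->
  E (fun x => bank m (f x)) <= bank m k.
Proof.
have Ecst c : 0 <= c -> E (fun=> c) <= c.
  by case: c => [c _| |]//; rewrite ?outer_cst ?leey.
case: m => [r| |]//= r1 f0 Efk; last by apply: Ecst; rewrite le_max lexx.
(* The two additions differ only on opposite infinities, hence agree when one summand is real. *)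
have dE (c : R) (l : \bar R) : (c%:E + l)%dE = c%:E + l by case: l.
(* [outer_scale] needs a strictly positive factor, so a zero stake is treated apart. *)
have [<-|h0] := eqVneq 0%R (stake r).
  under eq_fun do rewrite mul0e adde0.
  by rewrite mul0e adde0 outer_cst.
under eq_fun do rewrite -dE.
apply: le_trans (outer_subadd E (fun=> (F r)%:E) _) _.
rewrite outer_cst outer_scale; last by rewrite lt_def eq_sym h0 stake_ge0.
by rewrite dE leeD2l// lee_wpmul2l// lee_fin stake_ge0.
Qed.

(** The 1 is the initial capital, which no recorded round contains. *)
Definition history_max (s : seq (round R X)) : \bar R :=
  maxe 1 (\big[maxe/-oo]_(r <- s) sceptic r (reality r)).

Lemma history_max_mkseq (p : play R X) n :
  history_max (mkseq p n) = max_capital p n.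
Proof.
by rewrite /max_capital big_ord_recl /history_max big_map -val_enum_ord big_map
  big_enum.
Qed.

Lemma max_capitalS (p : play R X) n :
  max_capital p n.+1 = maxe (max_capital p n) (capital (@sceptic R X) p n.+1).
Proof. by rewrite /max_capital big_ord_recr. Qed.

Lemma max_capital_ge1 (p : play R X) n : 1 <= max_capital p n.
Proof. by rewrite -history_max_mkseq le_max lexx. Qed.

Definition bank_strategy : strategy R X :=
  fun s _ f x => bank (history_max s) (f x).

Lemma capital_ge0 player (p : play R X) n :
  plays_legally player p -> 0 <= capital player p n.
Proof.
by case: n => [|n] legal; [exact: lee01|have [f0 _] := legal n; exact: f0].
Qed.

(** After a round Rival Sceptic holds exactly [bank] at the old maximum and the new capital, and
    [bank_max] passes to the new maximum; no induction is involved. *)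
Lemma bank_le_rival_capital (p : play R X) n :
  plays_legally (@sceptic R X) p -> follows bank_strategy p ->
  bank (max_capital p n) (capital (@sceptic R X) p n) <=
  capital (@rival R X) p n.
Proof.
move=> legal foll; case: n => [|n].
  rewrite /max_capital big_ord_recl big_ord0 maxeNy /= mule1 -EFinD lee_fin.
  exact: stake_init.
rewrite max_capitalS [leRHS]/= foll /bank_strategy history_max_mkseq.
by apply: bank_max; [exact: max_capital_ge1|exact: (capital_ge0 _ _ n.+1)].
Qed.

Lemma bank_strategy_legal : legal_strategy bank_strategy.
Proof.
move=> p legal foll n; rewrite foll /bank_strategy history_max_mkseq.
have [f0 Ef] := legal n; split=> [x|].
  by rewrite bank_ge0// max_capital_ge1.
apply: le_trans (bank_le_rival_capital p n legal foll).
by apply: outer_bank => //; exact: max_capital_ge1.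
Qed.

Lemma calibrator_of_integral_le1 : capital_calibrator X F.
Proof.
split=> //; exists bank_strategy; split; first exact: bank_strategy_legal.
move=> p legal foll n; apply: le_trans (bank_le_rival_capital p n legal foll).
by apply: extend_oo_le_bank; [exact: max_capital_ge1|exact: capital_ge0].
Qed.

End strategy.

(** * Expectations on two points as outer contents *)

Section two_point_content.
Context {R : realType} (X : Type) (a b : X) (w : R).
Hypotheses (w0 : (0 < w)%R) (w1 : (w < 1)%R).

(** The dual sum lets [+oo] at one point prevail over [-oo] at the other, in line with the
    convention of [outer_subadd]. *)
Definition two_point_val (f : X -> \bar R) : \bar R :=
  (w%:E * f a + (1 - w)%:E * f b)%dE.

Let v0 : (0 < 1 - w)%R. Proof. by rewrite subr_gt0. Qed.

Let pmul_dD (c : R) (x y : \bar R) : (0 < c)%R ->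
  c%:E * (x + y)%dE = (c%:E * x + c%:E * y)%dE.
Proof.
move=> c0; case: x y => [x| |] [y| |] //=;
  rewrite ?gt0_muley ?gt0_muleNy ?lte_fin//.
by rewrite -EFinM mulrDr.
Qed.

Let two_point_le f g : (forall x, f x <= g x) ->
  two_point_val f <= two_point_val g.
Proof. by move=> fg; rewrite lee_dD// lee_wpmul2l// lee_fin ltW. Qed.

Let two_point_scale f (c : R) : (0 < c)%R ->
  two_point_val (fun x => c%:E * f x) = c%:E * two_point_val f.
Proof.
by move=> c0; rewrite /two_point_val pmul_dD// !(muleCA c%:E).
Qed.

Let two_point_subadd f g : two_point_val (fun x => (f x + g x)%dE) <=
  (two_point_val f + two_point_val g)%dE.
Proof. by rewrite /two_point_val !pmul_dD// daddeACA. Qed.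

Let two_point_cst c : two_point_val (fun=> c%:E) = c%:E.
Proof.
by rewrite /two_point_val -!EFinM -dEFinD -mulrDl addrC subrK mul1r.
Qed.

Definition two_point : outer_content R X :=
  OuterContent two_point_le two_point_scale two_point_subadd two_point_cst.

End two_point_content.

(** * Necessity: Sceptic multiplies his capital by [q] until he is ruined *)

Section doubling.
Context {R : realType} (X : Type) (a b : X) (q : R) (S : strategy R X).
Hypotheses (ab : a <> b) (q1 : (1 < q)%R).

Let q0 : (0 < q)%R. Proof. exact: lt_trans q1. Qed.

Let w0 : (0 < q^-1)%R. Proof. by rewrite invr_gt0. Qed.

Let w1 : (q^-1 < 1)%R. Proof. by rewrite invf_lt1. Qed.

Let E : outer_content R X := two_point X a b q^-1 w0 w1.

(* In the [N]-th play Reality moves [a] in the first [N] rounds, so that Sceptic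
   climbs to [q ^+ N], and then moves [b], which ruins him. *)
Definition doubling_move N n : X -> \bar R :=
  fun x => if (n <= N)%N && `[<x = a>] then (q ^+ n.+1)%:E else 0.

Definition doubling_reality N n : X := if (n < N)%N then a else b.

Definition doubling_round N n (h : seq (round R X)) : round R X :=
  Round E (doubling_move N n) (S h E (doubling_move N n))
    (doubling_reality N n).

(** The strategy [S] reads the past, so the finite histories are built by recursion first and the
    play is read off them. *)
Fixpoint doubling_history N n : seq (round R X) :=
  if n is m.+1 then
    rcons (doubling_history N m) (doubling_round N m (doubling_history N m))
  else [::].

Definition doubling_play N : play R X :=
  fun n => doubling_round N n (doubling_history N n).

Let mkseq_doubling_play N n : mkseq (doubling_play N) n = doubling_history N n.
Proof.
elim: n => // n IH.
by rewrite /mkseq -addn1 iotaD map_cat -/(mkseq _ _) IH addn1 /= cats1.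
Qed.

Lemma doubling_play_follows N : follows S (doubling_play N).
Proof. by move=> n; rewrite mkseq_doubling_play. Qed.

(** Plays [N] and [N.+1] part only when Reality answers in round [N], so Rival Sceptic makes the
    same move in that round of both. *)
Let doubling_historyS N n : (n <= N)%N ->
  doubling_history N.+1 n = doubling_history N n.
Proof.
elim: n => //= n IH nN; rewrite IH; last exact: ltnW.
congr rcons; rewrite /doubling_round; congr Round.
- by rewrite /doubling_move (ltnW nN) leqW// ltnW.
- by congr S; rewrite /doubling_move (ltnW nN) leqW// ltnW.
- by rewrite /doubling_reality nN ltnS ltnW.
Qed.

Let capital_doubling N n : (n <= N)%N ->
  capital (@sceptic R X) (doubling_play N) n = (q ^+ n)%:E.
Proof.
case: n => [|n] nN /=; first by rewrite expr0.
by rewrite /doubling_reality nN /doubling_move (ltnW nN)/= asboolT.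
Qed.

Let capital_doubling_ruin N :
  capital (@sceptic R X) (doubling_play N) N.+1 = 0.
Proof.
rewrite /= /doubling_reality ltnn /doubling_move asboolF ?andbF//.
by move=> /esym.
Qed.

Lemma doubling_play_legal N : plays_legally (@sceptic R X) (doubling_play N).
Proof.
move=> n; split=> [x|].
  rewrite /= /doubling_move; case: ifP => // _.
  by rewrite lee_fin exprn_ge0// ltW.
have ba : `[<b = a>] = false by apply: asboolF => /esym.
rewrite /= /two_point_val /doubling_move ba andbF mule0 dadde0 asboolT//.
(* Up to round [N] the move costs [q^-1 * q ^+ n.+1], all of Sceptic's capital; afterwards he stakes
   nothing. *)
case: leqP => nN /=.
  by rewrite capital_doubling// -EFinM exprS mulKf// gt_eqF.
rewrite mule0; case: n nN => //= n nN.
rewrite /doubling_move; case: ifP => // _.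
by rewrite lee_fin exprn_ge0// ltW.
Qed.

Let max_capital_doubling N n : (n <= N)%N ->
  max_capital (doubling_play N) n = (q ^+ n)%:E.
Proof.
elim: n => [|n IH] nN.
  by rewrite /max_capital big_ord_recl big_ord0 maxeNy capital_doubling.
rewrite max_capitalS IH; last exact: ltnW.
by rewrite capital_doubling// max_r// lee_fin ler_eXn2l.
Qed.

Let max_capital_doubling_ruin N :
  max_capital (doubling_play N) N.+1 = (q ^+ N)%:E.
Proof.
rewrite max_capitalS max_capital_doubling// capital_doubling_ruin max_l//.
by rewrite lee_fin exprn_ge0// ltW.
Qed.

Context (F : R -> R).
Hypothesis legalS : legal_strategy S.
Hypothesis guarS : guarantees S (fun p => forall n,
  extend_oo F (max_capital p n) <= capital (@rival R X) p n).

Let k N := capital (@rival R X) (doubling_play N) N.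

Let rival_legal N : plays_legally (@rival R X) (doubling_play N).
Proof.
apply: legalS; [exact: doubling_play_legal|exact: doubling_play_follows].
Qed.

Let k_ge0 N : 0 <= k N. Proof. exact: capital_ge0. Qed.

(** Let [g] be Rival Sceptic's move in round [N]. Its value at [a] is his capital [k N.+1] in the
    next play, its value at [b] is at least [F (q ^+ N)] by the guarantee, and its price is at most
    [k N]. *)
Let k_step N : q^-1%:E * k N.+1 + ((1 - q^-1) * F (q ^+ N))%:E <= k N.
Proof.
have [g0 Eg] := rival_legal N N; apply: le_trans Eg.
have -> : k N.+1 = rival (doubling_play N N) a.
  rewrite /k /= /doubling_reality ltnS leqnn doubling_historyS//.
  by rewrite /doubling_move leqnn leqW.
have /(_ N.+1) := guarS _ (doubling_play_legal N) (doubling_play_follows N).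
rewrite max_capital_doubling_ruin [leRHS]/= /doubling_reality ltnn => Fg.
rewrite /= /two_point_val.
have -> (x y : \bar R) : 0 <= x -> 0 <= y -> (x + y)%dE = x + y.
  by case: x y => [x| |] [y| |].
  rewrite leeD2l// EFinM lee_wpmul2l// lee_fin subr_ge0 ltW//.
- rewrite mule_ge0 ?lee_fin ?(ltW w0)//; exact: g0.
- rewrite mule_ge0 ?lee_fin ?subr_ge0 ?(ltW w1)//; exact: g0.
Qed.

Lemma calibrator_sum_le1 N :
  (\sum_(i < N) F (q ^+ i) * ((q ^+ i)^-1 - (q ^+ i.+1)^-1) <= 1)%R.
Proof.
rewrite -lee_fin.
(* Keeping the discounted capital on the left closes the induction: [k_step] divided by [q ^+ N]
   telescopes, starting from [k 0 = 1]. *)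
suff : (\sum_(i < N) F (q ^+ i) * ((q ^+ i)^-1 - (q ^+ i.+1)^-1))%:E +
    ((q ^+ N)^-1)%:E * k N <= 1.
  apply: le_trans; rewrite leeDl// mule_ge0// lee_fin invr_ge0 exprn_ge0//.
  exact: ltW.
elim: N => [|N IH]; first by rewrite big_ord0 expr0 invr1 add0e mule1.
apply: le_trans IH; rewrite big_ord_recr/= EFinD -addeA leeD2l//.
have qN0 : (0 < (q ^+ N)^-1)%R by rewrite invr_gt0 exprn_gt0.
apply: le_trans (lee_wpmul2l _ (k_step N)); last by rewrite lee_fin ltW.
rewrite muleDr ?fin_num_adde_defl// muleA -!EFinM addeC exprS.
rewrite invfM (mulrC (q^-1)%R) leeD2l// lee_fin.
by rewrite [leRHS]mulrA [leLHS]mulrC mulrBr mulr1.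
Qed.

End doubling.

Lemma integral_le1_of_calibrator {R : realType} (X : Type) (F : R -> R) :
  (exists a b : X, a <> b) -> capital_calibrator X F ->
  calibration_integral F <= 1.
Proof.
move=> [a [b ab]] [incF [S [legalS guarS]]].
apply: calibration_integral_le1 => // q N q1.
apply: le_trans (ltW q1).
exact: (calibrator_sum_le1 _ _ _ _ _ ab q1 _ legalS guarS).
Qed.

(** * Right limits of increasing functions *)

Section right_limit.
Context {R : realType} (F : R -> R).
Hypothesis incF : increasing_from1 F.

(** For increasing [F] and [1 <= y] this infimum is the limit of [F] at [y] from the right. *)
Definition right_limit (y : R) : R := inf [set F z | z in `]y, +oo[].

Let right_limit_has_lbound y : (1 <= y)%R ->
  lbound [set F z | z in `]y, +oo[] (F y).
Proof.
move=> y1 _ [z /= + <-]; rewrite in_itv/= andbT => yz.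
by rewrite incF.2// ltW.
Qed.

Let right_limit_neq0 y : [set F z | z in `]y, +oo[] !=set0.
Proof.
by exists (F (y + 1)%R); exists (y + 1)%R => //=; rewrite in_itv/= andbT ltrDl.
Qed.

Lemma right_limit_ge y : (1 <= y)%R -> (F y <= right_limit y)%R.
Proof. by move=> y1; apply: lb_le_inf => //; exact: right_limit_has_lbound. Qed.

Lemma right_limit_le y z : (1 <= y)%R -> (y < z)%R -> (right_limit y <= F z)%R.
Proof.
move=> y1 yz; apply: ge_inf.
  by exists (F y); exact: right_limit_has_lbound.
by exists z => //=; rewrite in_itv/= andbT.
Qed.

Lemma right_limit_lt y x : (right_limit y < x)%R ->
  exists2 z, (y < z)%R & (F z < x)%R.
Proof.
move=> /(inf_lt (right_limit_neq0 y))[_ [z /= + <-]] Fz.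
by rewrite in_itv/= andbT => yz; exists z.
Qed.

Lemma increasing_right_limit : increasing_from1 right_limit.
Proof.
split=> [y y1|y z y1].
  exact: le_trans (incF.1 y y1) (right_limit_ge _ y1).
rewrite le_eqVlt => /predU1P[->//|yz].
apply: le_trans (right_limit_le _ _ y1 yz) _.
by apply: right_limit_ge; rewrite (le_trans y1)// ltW.
Qed.

Lemma right_continuous_of_right_limit_le :
  (forall y, (1 <= y)%R -> (right_limit y <= F y)%R) ->
  right_continuous_from1 F.
Proof.
move=> rF y y1; apply/cvgrPdist_le => e e0.
have [z yz Fz] : exists2 z, (y < z)%R & (F z < F y + e)%R.
  by apply: right_limit_lt; rewrite (le_lt_trans (rF _ y1))// ltrDl.
near=> x; have yx : (y < x)%R by near: x; exact: nbhs_right_gt.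
have xz : (x < z)%R by near: x; exact: nbhs_right_lt.
have := incF.2 _ _ y1 (ltW yx).
have := incF.2 _ _ (le_trans y1 (ltW yx)) (ltW xz).
by rewrite ler_distlC => *; apply/andP; split; lra.
Unshelve. all: by end_near. Qed.

(** At a grid point the right limit is at most [F] at the next one, so lower sums of [right_limit]
    lie below upper sums of [F], hence below [q]. *)
Lemma right_limit_integral_le1 :
  calibration_integral F <= 1 -> calibration_integral right_limit <= 1.
Proof.
move=> intF; apply: calibration_integral_le1 => [|q N q1].
  exact: increasing_right_limit.
have q0 : (0 < q)%R by rewrite (lt_trans _ q1).
have grid_ge0 i : (0 <= (q ^+ i)^-1 - (q ^+ i.+1)^-1)%R.
  by rewrite subr_ge0 lef_pV2 ?posrE ?exprn_gt0// ler_eXn2l.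
apply: (@le_trans _ _ (\sum_(i < N) F (q ^+ i.+1) *
    ((q ^+ i)^-1 - (q ^+ i.+1)^-1)))%R.
  apply: ler_sum => i _; rewrite ler_wpM2r//; apply: right_limit_le.
    by rewrite exprn_ege1// ltW.
  by rewrite ltr_eXn2l.
apply: le_trans (upper_sum_le _ _ _ incF q1) _.
rewrite -[leRHS]mulr1 ler_pM2l// -lee_fin.
by apply: le_trans intF; exact: lower_sum_le.
Qed.

End right_limit.

Lemma right_continuous_right_limit {R : realType} (F : R -> R) :
  increasing_from1 F -> right_continuous_from1 (right_limit F).
Proof.
move=> incF; apply: right_continuous_of_right_limit_le.
  exact: increasing_right_limit.
move=> y y1; apply: lb_le_inf => [|_ [z /= + <-]].
  exists (F (y + 1)%R); exists (y + 1)%R => //=.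
  by rewrite in_itv/= andbT ltrDl.
rewrite in_itv/= andbT => yz.
(* The midpoint leaves room for two right limits: the outer one is bounded by [right_limit F] there,
   and that one by [F z]. *)
have ym : (y < (y + z) / 2)%R by lra.
apply: le_trans (right_limit_le _ (increasing_right_limit _ incF) _ _ y1 ym) _.
by apply: right_limit_le => //; lra.
Qed.

(** * Domination and admissibility *)

Section admissibility.
Context {R : realType} (X : Type).
Local Notation mu := (@lebesgue_measure R).
Implicit Types (F G : R -> R).

Lemma increasing_from1D F c : increasing_from1 F -> (0 <= c)%R ->
  increasing_from1 (fun y => F y + c)%R.
Proof.
move=> [F0 Fle] c0; split=> [y y1|y z y1 yz]; first by rewrite addr_ge0// F0.
by rewrite lerD2r Fle.
Qed.

Lemma calibration_integralD F c : increasing_from1 F -> (0 <= c)%R ->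
  calibration_integral (fun y => F y + c)%R = calibration_integral F + c%:E.
Proof.
move=> incF c0; rewrite /calibration_integral.
under eq_integral do rewrite mulrDl EFinD.
rewrite ge0_integralD//=.
- by rewrite tail_integral_cst// divr1.
- by move=> y; rewrite in_itv/= andbT; exact: increasing_from1_div_ge0.
- exact: measurable_increasing_from1.
- move=> y; rewrite in_itv/= andbT => y1; rewrite lee_fin divr_ge0// sqr_ge0//.
- exact: (measurable_increasing_from1 (fun=> c)).
Qed.

Lemma calibration_integral_ge0 F : increasing_from1 F ->
  0 <= calibration_integral F.
Proof.
move=> incF; apply: integral_ge0 => y /=; rewrite in_itv/= andbT.
exact: increasing_from1_div_ge0.
Qed.

Lemma calibration_integral_fillup F : increasing_from1 F ->
  calibration_integral F <= 1 ->
  exists2 c : R, (0 <= c)%R & calibration_integral F + c%:E = 1.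
Proof.
move=> incF intF; have F0 := calibration_integral_ge0 _ incF.
move: (calibration_integral F) F0 intF => [i| |]//= _.
rewrite lee_fin => i1.
by exists (1 - i)%R; [rewrite subr_ge0|rewrite -EFinD addrC subrK].
Qed.

(** Right continuity spreads the strict inequality at [y] over an interval: between [y] and [z],
    [F <= F z < G y <= G]. *)
Lemma calibration_integral_lt F G : increasing_from1 F -> increasing_from1 G ->
  right_continuous_from1 F -> calibration_integral F < +oo ->
  strictly_dominates G F -> calibration_integral F < calibration_integral G.
Proof.
move=> incF incG rcF Ffin [FG [y [y1 Fy]]].
have [z yz Fz] : exists2 z, (y < z)%R & (F z < G y)%R.
  have /cvgr_lt/(_ _ Fy) FGy := rcF _ y1.
  have : \forall z \near y^'+, (y < z)%R /\ (F z < G y)%R.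
    by near=> z; split; near: z => //; exact: nbhs_right_gt.
  by move=> /filter_ex[z [yz Fz]]; exists z.
have z1 := le_trans y1 (ltW yz).
have y0 : (0 < y)%R by rewrite (lt_le_trans _ y1).
have z0 : (0 < z)%R by rewrite (lt_trans _ yz).
have mono (i : interval R) : [set` i] `<=` `[1%R, +oo[ ->
    \int[mu]_(x in [set` i]) (F x / x ^+ 2)%:E <=
    \int[mu]_(x in [set` i]) (G x / x ^+ 2)%:E.
  move=> i1; have ge1 x : [set` i] x -> (1 <= x)%R.
    by move=> /i1; rewrite /= in_itv/= andbT.
  apply: ge0_le_integral => //.
  - by move=> x /ge1; exact: increasing_from1_div_ge0.
  - exact: measurable_increasing_from1.
  - exact: measurable_increasing_from1.
  - by move=> x /ge1 x1; rewrite lee_fin ler_wpM2r ?invr_ge0 ?sqr_ge0// FG.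
have sub1y : `[1%R, y[ `<=` `[1%R, +oo[.
  by move=> x /=; rewrite !in_itv/= andbT => /andP[].
have subz : `[z, +oo[ `<=` `[1%R, +oo[.
  by move=> x /=; rewrite !in_itv/= !andbT; exact: le_trans.
have ge0 (i : interval R) : [set` i] `<=` `[1%R, +oo[ ->
    0 <= \int[mu]_(x in [set` i]) (F x / x ^+ 2)%:E.
  move=> i1; apply: integral_ge0 => x /i1 /=; rewrite in_itv/= andbT.
  exact: increasing_from1_div_ge0.
have fin (i : interval R) : [set` i] `<=` `[1%R, +oo[ ->
    \int[mu]_(x in [set` i]) (F x / x ^+ 2)%:E \is a fin_num.
  move=> i1; rewrite ge0_fin_numE; last exact: ge0.
  apply: le_lt_trans Ffin; apply: ge0_subset_integral => //.
  - exact: measurable_increasing_from1.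
  - by move=> x /=; rewrite in_itv/= andbT; exact: increasing_from1_div_ge0.
(* The outer pieces compare weakly and the middle one strictly; finiteness of the integrals of [F]
   keeps the sum strict. *)
rewrite /calibration_integral !(tail_integral_split _ 1%R y)//.
rewrite !(tail_integral_split _ y z) ?(ltW yz)//.
apply: lee_ltD; [exact: fin|exact: mono|].
apply: lte_leD; [exact: fin| |exact: mono].
apply: le_lt_trans (integral_increasing_le _ _ _ incF y1 (ltW yz)) _.
apply: lt_le_trans (integral_increasing_ge _ _ _ incG y1 (ltW yz)).
by rewrite lte_fin ltr_pM2r// subr_gt0 ltf_pV2.
Unshelve. all: by end_near. Qed.

Hypothesis hX : exists a b : X, a <> b.

Lemma capital_calibratorP F : increasing_from1 F ->
  capital_calibrator X F <-> calibration_integral F <= 1.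
Proof.
move=> incF; split; first exact: integral_le1_of_calibrator.
exact: calibrator_of_integral_le1.
Qed.

(** A failure of right continuity makes [right_limit F] a strict dominator, and missing mass [c]
    makes [F + c] one. Conversely, a strict dominator of [F] would have an integral above 1. *)
Lemma admissibleP F : capital_calibrator X F ->
  admissible X F <-> right_continuous_from1 F /\ calibration_integral F = 1.
Proof.
move=> calF; have incF := calF.1.
have intF := (capital_calibratorP _ incF).1 calF.
split=> [[_ maxF]|[rcF F1]]; last first.
  split=> // -[G [calG domG]]; have := (capital_calibratorP _ calG.1).1 calG.
  rewrite leNgt -F1 calibration_integral_lt//; first exact: calG.1.
  by rewrite F1 ltey.
split.
  apply: right_continuous_of_right_limit_le => // y y1.
  rewrite leNgt; apply/negP => Fy; apply: maxF; exists (right_limit F); split.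
    apply/capital_calibratorP; first exact: increasing_right_limit.
    exact: right_limit_integral_le1.
  by split=> [x x1|]; [exact: right_limit_ge|exists y].
have [c c0 Fc] := calibration_integral_fillup _ incF intF.
suff : c = 0%R by move=> c00; rewrite -Fc c00 adde0.
apply/eqP; rewrite eq_le c0 andbT leNgt; apply/negP => c_gt0; apply: maxF.
exists (fun y => F y + c)%R; split.
  apply/capital_calibratorP; first exact: increasing_from1D.
  by rewrite calibration_integralD// Fc.
split=> [y y1|]; first by rewrite lerDl.
by exists 1%R; rewrite ltrDl.
Qed.

(** The right limit is taken before the missing mass is added: the constant preserves right
    continuity and brings the integral to exactly 1. *)
Lemma dominated_by_admissible F : capital_calibrator X F ->
  exists G, admissible X G /\ dominates G F.
Proof.
move=> calF; have incF := calF.1; have incr := increasing_right_limit _ incF.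
have /(right_limit_integral_le1 _ incF) intr :=
  (capital_calibratorP _ incF).1 calF.
have [c c0 Fc] := calibration_integral_fillup _ incr intr.
exists (fun y => right_limit F y + c)%R; split; last first.
  by move=> y y1; rewrite (le_trans (right_limit_ge _ incF _ y1))// lerDl.
have int1 : calibration_integral (fun y => right_limit F y + c)%R = 1.
  by rewrite calibration_integralD.
apply/admissibleP.
  by apply/capital_calibratorP; [exact: increasing_from1D|rewrite int1].
split=> // y y1; apply: cvgD; last exact: cvg_cst.
exact: right_continuous_right_limit.
Qed.

End admissibility.

Theorem theorem1 (R : realType) (X : Type) (hX : exists a b : X, a <> b) :
  (forall F : R -> R, increasing_from1 F ->
     (capital_calibrator X F <-> calibration_integral F <= 1)) /\
  (forall F : R -> R, capital_calibrator X F ->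
     exists G : R -> R, admissible X G /\ dominates G F) /\
  (forall F : R -> R, capital_calibrator X F ->
     (admissible X F <->
      right_continuous_from1 F /\ calibration_integral F = 1)).
Proof.
split; first exact: capital_calibratorP.
by split; [exact: dominated_by_admissible|exact: admissibleP].
Qed.
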